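(* Consider the cost $c(x,y)=|x-y|^2$ on $\mathbb{R}^d\times\mathbb{R}^d$ with marginals $\mu_1,\mu_2\in\mathcal{P}_{2+\delta}(\mathbb{R}^d)$ for some $\delta>0$. Then any optimal transport (any minimizer of $\pi\mapsto\int c\,d\pi$ over $\Pi(\mu_1,\mu_2)$) satisfies ${\sf quant}_2(C,1/d)$ for some $C>0$.
   Context: $\mathcal{P}_q(\mathbb{R}^d)$ denotes the Borel probability measures on $\mathbb{R}^d$ with finite $q$-th moment; $|\cdot|$ is the Euclidean norm; $\Pi(\mu_1,\mu_2)$ is the set of couplings of $\mu_1,\mu_2$. A measure $\pi\in\mathcal{P}_2(Y)$, $Y=\mathbb{R}^{d}\times\mathbb{R}^d$ with the Euclidean metric, satisfies ${\sf quant}_2(C,\alpha)$ if for every $n\ge1$ there is a probability measure $\pi^n$ on $Y$ supported on at most $n$ points with $W_2(\pi^n,\pi)\le Cn^{-\alpha}$, where $W_2$ is the 2-Wasserstein distance. *)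

(* Defs.v *)
From HB Require Import structures.
From mathcomp Require Import all_boot all_order all_algebra.
From mathcomp Require Import all_classical all_reals all_analysis.
Set Implicit Arguments.
Unset Strict Implicit.
Unset Printing Implicit Defensive.
Import Order.TTheory GRing.Theory Num.Theory.
Import numFieldNormedType.Exports.
Local Open Scope classical_set_scope.
Local Open Scope ring_scope.

(* R^d with its Borel sigma-algebra. The topology of 'rV_d comes from the sup
   norm, which is equivalent to the Euclidean one, so [open] is the usual
   notion. *)
Notation eucl R d := (g_sigma_algebraType (@open 'rV[R]_d)).

(* The library norm `|x| on 'rV_d is the sup norm, hence this definition. *)
Definition enorm (R : realType) (d : nat) (x : 'rV[R]_d) : R :=
  Num.sqrt (\sum_(i < d) x ord0 i ^+ 2).

(* Y = R^d x R^d carries the product sigma-algebra, which is its Borel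
   sigma-algebra since R^d is second countable. *)
Notation euclY R d := (eucl R d * eucl R d)%type.

Definition enormY (R : realType) (d : nat) (z : 'rV[R]_d * 'rV[R]_d) : R :=
  Num.sqrt (enorm z.1 ^+ 2 + enorm z.2 ^+ 2).

Definition edistY (R : realType) (d : nat) (z w : 'rV[R]_d * 'rV[R]_d) : R :=
  enormY (z.1 - w.1, z.2 - w.2).

Definition in_P (R : realType) (d : nat) (q : R)
    (mu : probability (eucl R d) R) : Prop :=
  (\int[mu]_x (enorm x `^ q)%:E < +oo)%E.

Definition in_PY (R : realType) (d : nat) (q : R)
    (pi : probability (euclY R d) R) : Prop :=
  (\int[pi]_z (enormY z `^ q)%:E < +oo)%E.

(* Measures in the library are functions on all sets, with no constraint off the
   measurable ones: marginals are compared on measurable sets only. *)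
Definition coupling (R : realType) (d1 d2 : measure_display)
    (T1 : measurableType d1) (T2 : measurableType d2)
    (mu1 : probability T1 R) (mu2 : probability T2 R) :
    set (probability (T1 * T2)%type R) :=
  [set pi | (forall A : set T1, measurable A -> pushforward pi fst A = mu1 A) /\
            (forall B : set T2, measurable B -> pushforward pi snd B = mu2 B)].

Definition transport_cost (R : realType) (d1 d2 : measure_display)
    (T1 : measurableType d1) (T2 : measurableType d2)
    (c : T1 -> T2 -> R) (pi : probability (T1 * T2)%type R) : \bar R :=
  (\int[pi]_z (c z.1 z.2)%:E)%E.

Definition optimal_transport (R : realType) (d1 d2 : measure_display)
    (T1 : measurableType d1) (T2 : measurableType d2) (c : T1 -> T2 -> R)
    (mu1 : probability T1 R) (mu2 : probability T2 R)
    (pi : probability (T1 * T2)%type R) : Prop :=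
  coupling mu1 mu2 pi /\
  forall pi' : probability (T1 * T2)%type R, coupling mu1 mu2 pi' ->
    (transport_cost c pi <= transport_cost c pi')%E.

Definition W2 (R : realType) (disp : measure_display) (T : measurableType disp)
    (dist : T -> T -> R) (mu nu : probability T R) : \bar R :=
  (ereal_inf [set transport_cost (fun x y => (dist x y ^+ 2)%R) g
             | g in coupling mu nu] `^ 2^-1)%E.

Definition quant2 (R : realType) (d : nat) (C alpha : R)
    (pi : probability (euclY R d) R) : Prop :=
  in_PY 2 pi /\
  forall n : nat, (1 <= n)%N ->
    exists (pin : probability (euclY R d) R) (s : seq (euclY R d)),
      [/\ (size s <= n)%N, pin [set` s] = 1%E &
          (W2 (T := euclY R d) (@edistY R d) pin pi <= (C * n%:R `^ (- alpha))%:E)%E].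

(* Main.v *)
Require Import Defs.
From HB Require Import structures.
From mathcomp Require Import all_boot all_order all_algebra.
From mathcomp Require Import all_classical all_reals all_analysis.
From mathcomp Require Import measurable_realfun.
From mathcomp Require Import ring lra zify.
Set Implicit Arguments.
Unset Strict Implicit.
Unset Printing Implicit Defensive.
Import Order.TTheory GRing.Theory Num.Theory.
Import numFieldNormedType.Exports.
Local Open Scope classical_set_scope.
Local Open Scope ring_scope.

(* An optimal plan pi charges only pairs z = (x, y), z' = (x', y') with
   <x - x', y - y'> >= 0, in the sense that the positive part of the gain from
   exchanging second components has zero integral against the product measure of
   pi with itself. By Minty's change of variables u = x + y one then has |z - z'| <= |u - u'|, so that quantizing pi
   in R^d x R^d reduces to quantizing the law of u in R^d. For the latter, each
   coordinate of u is compressed into (-1, 1) by a map t |-> 1 - (1 + |t|)^(-th)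
   (odd extension) with th = delta / 2 and cut into m intervals of equal length,
   which gives m^d cells. Within a cell, |u - u'|^2 is of order
   m^-2 ((1 + |u|)^(2 + delta) + (1 + |u'|)^(2 + delta)), which is integrable by
   the moment assumption; a representative of the cell chosen by averaging
   therefore yields a squared error of order m^-2 with m of order n^(1/d). *)

(** * Choice of cell representatives by averaging *)

(** Otherwise [f] would exceed its average [a] everywhere on [Q], so that [f - a] would be positive
    on [Q] with zero integral, which is impossible on a set of positive measure. Multiplying by
    [mu Q] avoids a division in the extended reals. *)
Lemma exists_le_average (d : measure_display) (T : measurableType d)
    (R : realType) (mu : {finite_measure set T -> \bar R}) (Q : set T)
    (f : T -> \bar R) :
  measurable Q -> measurable_fun Q f -> (forall z, 0 <= f z)%E ->
  (0 < mu Q)%E ->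
  exists2 z, Q z & (f z * mu Q <= \int[mu]_(x in Q) f x)%E.
Proof.
move=> mQ mf f0 Qgt0.
have Qfin : mu Q \is a fin_num by exact: fin_num_measure.
have p0 : 0 < fine (mu Q) by rewrite fine_gt0// Qgt0 ltey_eq Qfin.
apply: contrapT => noz.
have lt_f z : Q z -> (\int[mu]_(x in Q) f x < f z * mu Q)%E.
  by move=> Qz; rewrite ltNge; apply/negP => le_f; apply: noz; exists z.
have [z0 Qz0] : Q !=set0.
  by apply/set0P/negP => /eqP Q0; rewrite Q0 measure0 ltxx in Qgt0.
have int_ge0 : (0 <= \int[mu]_(x in Q) f x)%E by exact: integral_ge0.
have intfin : (\int[mu]_(x in Q) f x)%E \is a fin_num.
  by rewrite ge0_fin_numE// (lt_le_trans (lt_f _ Qz0))// leey.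
pose a := fine (\int[mu]_(x in Q) f x)%E / fine (mu Q).
have a0 : 0 <= a by apply: divr_ge0; rewrite fine_ge0.
have a_mu : (a%:E * mu Q = \int[mu]_(x in Q) f x)%E.
  by rewrite -(fineK Qfin) -(fineK intfin) -EFinM /a divfK// gt_eqF.
have lt_af z : Q z -> (a%:E < f z)%E.
  by move=> /lt_f; rewrite -a_mu lte_pmul2r.
have sub_ge0 z : Q z -> (0 <= f z - a%:E)%E.
  by move=> /lt_af /ltW; rewrite sube_ge0.
have msub : measurable_fun Q (fun z => f z - a%:E)%E.
  by apply: emeasurable_funB.
have int0 : (\int[mu]_(z in Q) (f z - a%:E) = 0)%E.
  (* As [f] may be infinite, only additivity for nonnegative functions is used; the finite quantity
     [a * mu Q] is then cancelled. *)
  have : (\int[mu]_(x in Q) ((f x - a%:E) + a%:E) = a%:E * mu Q)%E.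
    by rewrite a_mu; apply: eq_integral => x _; rewrite subeK.
  rewrite ge0_integralD//.
  rewrite integral_cst// => h.
  have amu_fin : (a%:E * mu Q)%E \is a fin_num by rewrite a_mu.
  by rewrite -[LHS](addeK _ amu_fin) h subee.
have int0' : (\int[mu]_(z in Q) `|f z - a%:E| = 0)%E.
  by rewrite -int0; apply: eq_integral => z /[!inE] Qz; rewrite gee0_abs ?sub_ge0.
have [A [mA A0 QA]] : ae_eq mu Q (fun z => f z - a%:E)%E (cst 0%E).
  exact/ae_eq_integral_abs.
have : (mu Q <= mu A)%E.
  apply: le_measure; rewrite ?inE// => z Qz; apply: QA => /= /(_ Qz) fa0.
  by have := lt_af _ Qz; rewrite -sube_gt0 fa0 ltxx.
by rewrite A0 leNgt Qgt0.
Qed.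

(* Some candidate in a cell does no worse than the average candidate, whose cost
   is an average over pairs of points of the cell. *)
Lemma exists_cell_representatives (d : measure_display) (T : measurableType d)
    (R : realType) (P : probability T R) (I : finType) (q : T -> I)
    (D N : T * T -> R) (W : T -> R) :
  (forall i, measurable (q @^-1` [set i])) ->
  measurable_fun setT D -> measurable_fun setT N -> measurable_fun setT W ->
  (forall z, 0 <= D z) -> (forall z, 0 <= N z) -> (forall z, 0 <= W z) ->
  (\int[P]_z (W z)%:E < +oo)%E ->
  (\int[P \x P]_z (N z)%:E = 0)%E ->
  (forall z w, q z = q w -> D (z, w) <= W z + W w + N (z, w)) ->
  exists c : I -> T,
    (\int[P]_z (D (z, c (q z)))%:E <= 2%:E * \int[P]_z (W z)%:E)%E.
Proof.
move=> mq mD mN mW D0 N0 W0 Wfin Nint0 DWN.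
have mDc w : measurable_fun setT (fun z => (D (z, w))%:E).
  by apply/measurable_EFinP; exact: measurable_fun_pair1.
have mWE : measurable_fun setT (EFin \o W) by exact/measurable_EFinP.
have mNE : measurable_fun setT (EFin \o N) by exact/measurable_EFinP.
have mS (S : set T) (f : T -> \bar R) :
    measurable_fun setT f -> measurable_fun S f by exact: measurable_funTS.
have intWQ (Q : set T) : measurable Q ->
    (\int[P]_(z in Q) (W z)%:E)%E \is a fin_num.
  move=> mQ; rewrite ge0_fin_numE; last by apply: integral_ge0 => z _; rewrite lee_fin.
  apply: le_lt_trans Wfin; apply: ge0_subset_integral => //.
  by move=> z _; rewrite lee_fin.
have cell i : exists c : T, (\int[P]_(z in q @^-1` [set i]) (D (z, c))%:E <=
    2%:E * \int[P]_(z in q @^-1` [set i]) (W z)%:E)%E.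
  set Q := q @^-1` [set i].
  have mQ : measurable Q by exact: mq.
  have [PQ0|PQgt0] := eqVneq (P Q) 0%E.
    (* A null cell contributes nothing, so its representative is an arbitrary default point. *)
    exists point; rewrite null_set_integral//; last exact: mS.
    by rewrite mule_ge0// integral_ge0// => z _; rewrite lee_fin.
  have {}PQgt0 : (0 < P Q)%E by rewrite lt_neqAle eq_sym PQgt0 measure_ge0.
  have PQfin : P Q \is a fin_num by exact: fin_num_measure.
  pose f w := (\int[P]_(z in Q) (D (z, w))%:E)%E.
  (* Seen as a partial integral of [D] cut off to [z] in [Q], the cost [f] is measurable in the
     candidate [w] by Tonelli. *)
  have fE w : f w = fubini_G P (EFin \o (fun x => D x * \1_Q x.1)) w.
    rewrite /f integral_mkcond; apply: eq_integral => z _.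
    by rewrite /= patchE indicE; case: ifPn => zQ; rewrite ?mulr1 ?mulr0.
  have mf : measurable_fun setT f.
    rewrite (funext fE); apply: measurable_fun_fubini_tonelli_G => //=.
    - apply/measurable_EFinP; apply: measurable_funM => //.
      apply: (@measurableT_comp _ _ _ _ _ _ (\1_Q : T -> R)) => //.
    - by move=> x; rewrite lee_fin mulr_ge0// indicE.
  have f0 w : (0 <= f w)%E by apply: integral_ge0 => z _; rewrite lee_fin.
  have [c Qc fc] := exists_le_average mQ (mS _ _ mf) f0 PQgt0.
  exists c; rewrite -/(f c).
  have [w wE] : exists w, w = (\int[P]_(z in Q) (W z)%:E)%E by eexists.
  rewrite -wE.
  have w0 : (0 <= w)%E by rewrite wE; apply: integral_ge0 => z _; rewrite lee_fin.
  have mG : measurable_fun setT (fubini_G P (EFin \o N)).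
    by apply: measurable_fun_fubini_tonelli_G => // z; rewrite lee_fin.
  have G0 y : (0 <= fubini_G P (EFin \o N) y)%E.
    by apply: integral_ge0 => z _; rewrite lee_fin.
  (* The nonnegative [N] has zero integral on the whole product, hence also on the strip where [y]
     lies in [Q]. *)
  have intG : (\int[P]_(y in Q) fubini_G P (EFin \o N) y = 0)%E.
    apply/eqP; rewrite eq_le integral_ge0 ?andbT; last by move=> z _.
    rewrite -[leRHS]Nint0 fubini_tonelli2//.
    exact: ge0_subset_integral.
  have le_f y : Q y -> (f y <= w + P Q * (W y)%:E + fubini_G P (EFin \o N) y)%E.
    move=> Qy.
    apply: (@le_trans _ _ (\int[P]_(z in Q) ((W z)%:E + (W y)%:E + (N (z, y))%:E))%E).
      apply: ge0_le_integral => //.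
      - by move=> z _; rewrite lee_fin.
      - exact: mS.
      - apply: mS; apply: emeasurable_funD => //; first exact: emeasurable_funD.
        by apply/measurable_EFinP; exact: measurable_fun_pair1.
      - by move=> z Qz; rewrite -!EFinD lee_fin DWN// Qz Qy.
    have mNy : measurable_fun setT (fun z => (N (z, y))%:E).
      by apply/measurable_EFinP; exact: measurable_fun_pair1.
    have W0E z : Q z -> (0 <= (W z)%:E)%E by rewrite lee_fin.
    have N0E z : Q z -> (0 <= (N (z, y))%:E)%E by rewrite lee_fin.
    have mWQ : measurable_fun Q (EFin \o W) by exact: mS.
    have Wy0 z : Q z -> (0 <= cst (W y)%:E z)%E by rewrite lee_fin.
    rewrite (ge0_integralD _ mQ _ _ N0E (mS _ _ mNy)); first last.
    - by apply: emeasurable_funD.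
    - by move=> z Qz; rewrite adde_ge0// lee_fin.
    rewrite (ge0_integralD _ mQ W0E mWQ Wy0)//.
    rewrite -wE integral_cst// [(_ * P Q)%E]muleC leeD2l//.
    by apply: ge0_subset_integral => // z _; rewrite lee_fin.
  (* Averaging the bound over candidates [y] in [Q] turns each of [w] and [P Q * W y] into
     [w * P Q]: this is the factor 2. *)
  have : (f c * P Q <= 2%:E * w * P Q)%E.
    apply: (le_trans fc); apply: (@le_trans _ _
      (\int[P]_(y in Q) (w + P Q * (W y)%:E + fubini_G P (EFin \o N) y))%E).
      apply: ge0_le_integral => //; first exact: mS.
      apply: mS; apply: emeasurable_funD => //; apply: emeasurable_funD => //.
      exact: measurable_funeM.
    have mPW : measurable_fun setT (fun y => P Q * (W y)%:E)%E.
      exact: measurable_funeM.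
    have PW0 y : (0 <= P Q * (W y)%:E)%E by rewrite mule_ge0// lee_fin.
    rewrite ge0_integralD//; last 3 first.
    - by move=> y _; rewrite adde_ge0.
    - by apply: mS; apply: emeasurable_funD.
    - exact: mS.
    rewrite intG adde0 ge0_integralD//; last exact: mS.
    have -> : (\int[P]_(y in Q) w = w * P Q)%E by exact: integral_cst.
    rewrite ge0_integralZl//; last 2 first.
    - exact: mS.
    - by move=> z _; rewrite lee_fin.
    have wfin : w \is a fin_num by rewrite wE; exact: intWQ.
    rewrite -wE -(fineK PQfin) -(fineK wfin) -!EFinM -EFinD lee_fin.
    by lra.
  by rewrite lee_pmul2r.
have [c cP] := choice cell.
exists c.
have split_cells (f : T -> R) : measurable_fun setT f -> (forall z, 0 <= f z) ->
    (\int[P]_z (f z)%:E = \sum_i \int[P]_(z in q @^-1` [set i]) (f z)%:E)%E.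
  move=> mf f0; under [RHS]eq_bigr do rewrite integral_mkcond.
  rewrite -ge0_integral_sum//.
  - apply: eq_integral => z _; rewrite (bigD1 (q z))//= patchE mem_set//.
    rewrite big1 ?adde0// => i iqz; rewrite patchE memNset// => /= qzi.
    by rewrite qzi eqxx in iqz.
  - move=> i; apply/(measurable_restrictT _ (mq i)); apply: mS.
    exact/measurable_EFinP.
  - by move=> i z _; rewrite erestrict_ge0// => ? _; rewrite lee_fin.
have mDq : measurable_fun setT (fun z => D (z, c (q z))).
  rewrite (_ : (fun z => _) =
      (fun z => \sum_i \1_(q @^-1` [set i]) z * D (z, c i))); last first.
    apply/funext => z; rewrite (bigD1 (q z))//= indicE mem_set// mul1r.
    rewrite big1 ?addr0// => i iqz; rewrite indicE memNset ?mul0r// => /= qzi.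
    by rewrite qzi eqxx in iqz.
  apply: measurable_sum => i; apply: measurable_funM; first exact: measurable_indic.
  exact: measurable_fun_pair1.
rewrite !split_cells// ge0_sume_distrr; last first.
  by move=> i _; apply: integral_ge0 => z _; rewrite lee_fin.
apply: lee_sum => i _; rewrite (le_trans _ (cP i))//.
rewrite le_eqVlt; apply/orP; left; apply/eqP; apply: eq_integral => z.
by rewrite inE => /= ->.
Qed.

(** * Image measures and exchanges in an optimal plan *)

(** Keeps the measurability of [f] a plain hypothesis: the bundled map required by [distribution] is
    built inside the proof. *)
Lemma exists_image_probability (d d' : measure_display) (T : measurableType d)
    (T' : measurableType d') (R : realType) (P : probability T R) (f : T -> T') :
  measurable_fun setT f ->
  exists P' : probability T' R, (forall A, P' A = P (f @^-1` A)) /\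
    forall g : T' -> \bar R, measurable_fun setT g -> (forall y, 0 <= g y)%E ->
      (\int[P']_y g y = \int[P]_x g (f x))%E.
Proof.
move=> mf; pose F : {mfun T >-> T'} := HB.pack f (isMeasurableFun.Build _ _ _ _ _ mf).
exists (distribution P F); split => // g mg g0.
by rewrite ge0_integral_distribution.
Qed.

Lemma integral_prod_swap (d : measure_display) (T : measurableType d)
    (R : realType) (P : probability T R) (f : T * T -> \bar R) :
  measurable_fun setT f -> (forall z, 0 <= f z)%E ->
  (\int[P \x P]_z f z = \int[P \x P]_z f (z.2, z.1))%E.
Proof.
move=> mf f0; rewrite fubini_tonelli2// fubini_tonelli1//=.
by apply: measurableT_comp => //; exact: measurable_swap.
Qed.

(* Competitor: draw z and z' independently from pi and exchange their second
   components whenever this lowers the cost; as the exchange condition is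
   symmetric in (z, z'), the law of the first pair obtained is again a coupling. *)
Lemma optimal_transport_exchange (R : realType) (d1 d2 : measure_display)
    (T1 : measurableType d1) (T2 : measurableType d2) (c : T1 -> T2 -> R)
    (mu1 : probability T1 R) (mu2 : probability T2 R)
    (pi : probability (T1 * T2)%type R) :
  measurable_fun setT (fun z : T1 * T2 => c z.1 z.2) ->
  (forall x y, 0 <= c x y) ->
  optimal_transport c mu1 mu2 pi ->
  (transport_cost c pi < +oo)%E ->
  (\int[pi \x pi]_z (Num.max 0
     (c z.1.1 z.1.2 + c z.2.1 z.2.2 - c z.1.1 z.2.2 - c z.2.1 z.1.2))%:E = 0)%E.
Proof.
move=> mc c0 [[pi1 pi2] pi_min] cost_fin.
set gain := fun z : (T1 * T2) * (T1 * T2) =>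
  c z.1.1 z.1.2 + c z.2.1 z.2.2 - c z.1.1 z.2.2 - c z.2.1 z.1.2.
have gainC z : gain (z.2, z.1) = gain z by rewrite /gain /=; lra.
have mcc (f : (T1 * T2) * (T1 * T2) -> T1) (g : (T1 * T2) * (T1 * T2) -> T2) :
    measurable_fun setT f -> measurable_fun setT g ->
    measurable_fun setT (fun t => c (f t) (g t)).
  move=> mf mg; exact: (measurableT_comp mc (measurable_fun_pair mf mg)).
have m1 : measurable_fun setT (fun z : (T1 * T2) * (T1 * T2) => z.1.1).
  exact: (measurableT_comp measurable_fst measurable_fst).
have m2 : measurable_fun setT (fun z : (T1 * T2) * (T1 * T2) => z.1.2).
  exact: (measurableT_comp measurable_snd measurable_fst).
have m1' : measurable_fun setT (fun z : (T1 * T2) * (T1 * T2) => z.2.1).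
  exact: (measurableT_comp measurable_fst measurable_snd).
have m2' : measurable_fun setT (fun z : (T1 * T2) * (T1 * T2) => z.2.2).
  exact: (measurableT_comp measurable_snd measurable_snd).
have mgain : measurable_fun setT gain.
  by do 2![apply: measurable_funB; last exact: mcc];
    apply: measurable_funD; exact: mcc.
have mS : measurable_fun setT (fun z => 0 < gain z) by exact: measurable_fun_ltr.
have mgainp : measurable_fun setT (fun z => Num.max 0 (gain z)).
  exact: measurable_maxr.
pose F z := (z.1.1, if 0 < gain z then z.2.2 else z.1.2).
have mF : measurable_fun setT F.
  by apply: measurable_fun_pair => //; exact: measurable_fun_ifT.
have [pi' [pi'E pi'int]] := exists_image_probability (pi \x pi)%E mF.
have int1 (h : T1 * T2 -> \bar R) : measurable_fun setT h -> (forall z, 0 <= h z)%E ->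
    (\int[pi \x pi]_z h z.1 = \int[pi]_z h z)%E.
  move=> mh h0; rewrite fubini_tonelli1//=; last exact: measurableT_comp.
  apply: eq_integral => z _; rewrite -[RHS]mule1 -(probability_setT pi).
  exact: (integral_cst pi measurableT (h z)).
have second_marginal (h : T2 -> R) : measurable_fun setT h -> (forall y, 0 <= h y) ->
    (\int[pi \x pi]_z (h (F z).2)%:E = \int[pi \x pi]_z (h z.1.2)%:E)%E.
  move=> mh h0.
  pose S := [set z | 0 < gain z].
  have SE z : (z \in S) = (0 < gain z) by apply/idP/idP; rewrite inE.
  have mS' : measurable S by rewrite -[S]setTI; exact: (mS measurableT [set true]).
  have mI : measurable_fun setT (\1_S : _ -> R) by exact: measurable_indic.
  have mI' : measurable_fun setT (\1_(~` S) : _ -> R).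
    by apply: measurable_indic; exact: measurableC.
  have mh2 := measurableT_comp mh m2.
  have mh2' := measurableT_comp mh m2'.
  have I0 A z : (0 <= (\1_A z : R)) by rewrite indicE.
  transitivity (\int[pi \x pi]_z
      ((\1_S z * h z.2.2)%:E + (\1_(~` S) z * h z.1.2)%:E))%E.
    apply: eq_integral => z _; rewrite !indicE in_setC /F /= -EFinD.
    rewrite SE.
    by case: ifP; rewrite ?mul1r ?mul0r ?addr0 ?add0r.
  rewrite ge0_integralD//; first last.
  - by apply/measurable_EFinP; exact: measurable_funM.
  - by move=> z _; rewrite lee_fin mulr_ge0.
  - by apply/measurable_EFinP; exact: measurable_funM.
  - by move=> z _; rewrite lee_fin mulr_ge0.
  (* By [gainC] the exchange set [S] is invariant under swapping [z] and [z']; the swap therefore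
     turns the integral of [h z.2.2] over [S] into that of [h z.1.2] over [S], and the two pieces
     recombine. *)
  rewrite [X in (X + _)%E]integral_prod_swap; first last.
  - by move=> z; rewrite lee_fin mulr_ge0.
  - by apply/measurable_EFinP; exact: measurable_funM.
  rewrite -ge0_integralD//; first last.
  - by apply/measurable_EFinP; exact: measurable_funM.
  - by move=> z _; rewrite lee_fin mulr_ge0.
  - apply/measurable_EFinP; apply: measurable_funM => //.
    by apply: (measurableT_comp mI); exact: measurable_swap.
  - by move=> z _; rewrite lee_fin mulr_ge0.
  apply: eq_integral => z _; rewrite !indicE in_setC /= -EFinD.
  have -> : ((z.2, z.1) \in S) = (z \in S).
    by rewrite !SE gainC.
  by case: (z \in S); rewrite ?mul1r ?mul0r ?addr0 ?add0r.
have pi'_coupling : coupling mu1 mu2 pi'.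
  split=> [A mA|B mB]; rewrite /pushforward.
  - rewrite pi'E -pi1// /pushforward -[LHS]/((pi \x pi)%E ((fst \o fst) @^-1` A)).
    have -> : (fst \o fst) @^-1` A = (fst @^-1` A : set (T1 * T2)) `*` [set: T1 * T2].
      by apply/seteqP; split => [[z w]//|[z w] []].
    have mA1 : measurable (fst @^-1` A : set (T1 * T2)).
      by have := @measurable_fst _ _ T1 T2 measurableT _ mA; rewrite setTI.
    by rewrite -[RHS]mule1 -(probability_setT pi) -product_measure1E.
  - have mB2 : measurable (snd @^-1` B : set (T1 * T2)).
      by have := @measurable_snd _ _ T1 T2 measurableT _ mB; rewrite setTI.
    have mIB : measurable_fun setT (\1_B : T2 -> R) by exact: measurable_indic.
    rewrite -pi2// /pushforward.
    rewrite -[in LHS](setIT (_ @^-1` B)) -[in RHS](setIT (_ @^-1` B)).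
    rewrite -!integral_indic//.
    have mIB2 : measurable_fun setT
        (fun z => (\1_(snd @^-1` B : set (T1 * T2)) z : R)%:E).
      by apply/measurable_EFinP; exact: measurable_indic.
    have IB0 z : (0 <= (\1_(snd @^-1` B : set (T1 * T2)) z : R)%:E)%E.
      by rewrite lee_fin indicE.
    rewrite pi'int// -int1//.
    by apply: (second_marginal (\1_B : T2 -> R)) => // y; rewrite indicE.
have mcE : measurable_fun setT (fun z : T1 * T2 => (c z.1 z.2)%:E).
  exact/measurable_EFinP.
have mcF : measurable_fun setT (fun z => (c (F z).1 (F z).2)%:E).
  exact: (measurableT_comp mcE mF).
have mswap := @measurable_swap _ _ (T1 * T2)%type (T1 * T2)%type.
have cost_pi' : transport_cost c pi' = (\int[pi \x pi]_z (c (F z).1 (F z).2)%:E)%E.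
  by rewrite /transport_cost pi'int// => z; rewrite lee_fin.
have cost_pi1 : transport_cost c pi = (\int[pi \x pi]_z (c z.1.1 z.1.2)%:E)%E.
  by rewrite /transport_cost -int1// => z; rewrite lee_fin.
have mc1 : measurable_fun setT
    (fun z : (T1 * T2) * (T1 * T2) => (c z.1.1 z.1.2)%:E).
  by apply/measurable_EFinP; exact: mcc.
have mc2 : measurable_fun setT
    (fun z : (T1 * T2) * (T1 * T2) => (c z.2.1 z.2.2)%:E).
  by apply/measurable_EFinP; exact: mcc.
have cost_pi2 : transport_cost c pi = (\int[pi \x pi]_z (c z.2.1 z.2.2)%:E)%E.
  by rewrite cost_pi1 integral_prod_swap// => z; rewrite lee_fin.
have mcFs : measurable_fun setT (fun z => (c (F (z.2, z.1)).1 (F (z.2, z.1)).2)%:E).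
  exact: (measurableT_comp mcF mswap).
have mgE : measurable_fun setT (fun z => (Num.max 0 (gain z))%:E).
  exact/measurable_EFinP.
have g0 z : (0 <= (Num.max 0 (gain z))%:E)%E by rewrite lee_fin le_max lexx.
(* Pointwise, the costs of the two pairs produced by the exchange plus the positive part of the gain
   equal the costs of the two original pairs. The additive form avoids subtracting possibly infinite
   integrals. *)
have balance : (transport_cost c pi' + transport_cost c pi' +
    \int[pi \x pi]_z (Num.max 0 (gain z))%:E =
    transport_cost c pi + transport_cost c pi)%E.
  rewrite {2}cost_pi2 {1}cost_pi1 cost_pi'.
  rewrite {2}integral_prod_swap//; last by move=> z; rewrite lee_fin.
  rewrite -!ge0_integralD//; try (by move=> z _; rewrite lee_fin ?addr_ge0);
    last exact: emeasurable_funD.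
  apply: eq_integral => z _; rewrite -!EFinD; congr (_%:E).
  rewrite /F /= gainC; have [gt0|le0] := ltP 0 (gain z).
    by rewrite /gain; lra.
  by rewrite addr0.
have /(pi_min pi') le_cost := pi'_coupling.
have cost0 (p : probability (T1 * T2)%type R) : (0 <= transport_cost c p)%E.
  by apply: integral_ge0 => z _; rewrite lee_fin.
have G0 : (0 <= \int[pi \x pi]_z (Num.max 0 (gain z))%:E)%E.
  by apply: integral_ge0 => z _; exact: g0.
(* Since the cost of [pi] is finite, all three quantities are real, and [2 s + t = 2 r] with
   [r <= s] and [0 <= t] forces [t = 0]. *)
move: balance le_cost G0 cost_fin (cost0 pi).
case: (transport_cost c pi) => [r| |] //; case: (transport_cost c pi') => [s| |] //;
  case: (\int[pi \x pi]_z _)%E => [t| |] //.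
rewrite -!EFinD => -[bal]; rewrite !lee_fin => le_rs t0 _ _.
by congr (_%:E); lra.
Qed.

(** * Compression of the real line to a bounded interval *)

(** This is the tangent inequality at [b] for the convex function [s |-> s^(-th)], multiplied by
    [b^(1 + th)]. The right side equals [b ((b / a)^th - 1)], and [exp x >= 1 + x] together with
    [ln (1 + x) <= x] gives the bound. *)
Lemma powR_compression (R : realType) (th a b : R) :
  0 < th -> 0 < a -> 0 < b ->
  th * (b - a) <= (a `^ (- th) - b `^ (- th)) * b `^ (1 + th).
Proof.
move=> th0 a0 b0.
have -> : (a `^ (- th) - b `^ (- th)) * b `^ (1 + th) =
    b * (expR (th * (ln b - ln a)) - 1).
  rewrite mulrBl -[X in _ - X]powRD ?(gt_eqF b0) ?implybT//.
  rewrite (_ : - th + (1 + th) = 1); last by ring.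
  rewrite powRr1 ?ltW// powRD ?(gt_eqF b0) ?implybT// powRr1 ?ltW//.
  rewrite mulrBr mulr1; congr (_ - _).
  rewrite mulrCA; congr (_ * _); rewrite /powR !gt_eqF// -expRD; congr expR.
  by ring.
have ln_ge : 1 - a / b <= ln b - ln a.
  have -> : ln b - ln a = - ln (1 + (a / b - 1)).
    by rewrite addrCA subrr addr0 ln_div ?posrE// opprB.
  rewrite lerNr opprB le_ln1Dx//.
  by have := divr_gt0 a0 b0; lra.
have := expR_ge1Dx (th * (ln b - ln a)) => exp_ge.
have -> : th * (b - a) = b * (th * (1 - a / b)).
  by field; rewrite gt_eqF.
rewrite ler_pM2l//; apply: (@le_trans _ _ (th * (ln b - ln a))).
  by rewrite ler_pM2l.
lra.
Qed.

(** The derivative is [th (1 + |t|)^(-1 - th)]: undoing the compression costs a factor whose square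
    grows like the power [2 + 2 th], the moment that is available. *)
Definition compress (R : realType) (th t : R) : R :=
  if 0 <= t then 1 - (1 + t) `^ (- th) else (1 - t) `^ (- th) - 1.

Lemma compress_itv (R : realType) (th t : R) :
  0 < th -> 0 <= (1 + compress th t) / 2 < 1.
Proof.
move=> th0.
have le1 (s : R) : 1 <= s -> 0 < s `^ (- th) <= 1.
  move=> s1; have s0 : 0 < s by lra.
  rewrite powR_gt0//= powRN invf_le1 ?powR_gt0//.
  by rewrite -(powRr0 s) ler_powR// ltW.
rewrite /compress; case: (leP 0 t) => t0.
  by have := le1 (1 + t); lra.
by have := le1 (1 - t); lra.
Qed.

Lemma measurable_compress (R : realType) (th : R) :
  measurable_fun setT (compress th).
Proof.
have mpow : measurable_fun setT (fun s : R => s `^ (- th)) by exact: measurable_powR.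
apply: measurable_fun_ifT.
- exact: measurable_fun_ler.
- apply: measurable_funB => //; apply: (measurableT_comp mpow).
  exact: measurable_funD.
- apply: measurable_funB => //; apply: (measurableT_comp mpow).
  exact: measurable_funB.
Qed.

(** On each half-line this is [powR_compression], with the weight enlarged to the common [M]. Points
    of opposite signs are compared through 0, where the two bounds add up. *)
Lemma dist_compress_le (R : realType) (th s t : R) : 0 < th ->
  th * `|s - t| <= `|compress th s - compress th t| *
    (Num.max (1 + `|s|) (1 + `|t|)) `^ (1 + th).
Proof.
move=> th0; set M := Num.max _ _.
have sM : 1 + `|s| <= M by rewrite le_max lexx.
have tM : 1 + `|t| <= M by rewrite le_max lexx orbT.
set P := M `^ (1 + th); have P0 : 0 <= P by exact: powR_ge0.
pose g a : R := 1 - (1 + a) `^ (- th).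
have base a b : 0 <= a -> a <= b -> 1 + b <= M -> th * (b - a) <= (g b - g a) * P.
  move=> a0 ab bM.
  rewrite (_ : b - a = (1 + b) - (1 + a)); last by ring.
  rewrite (_ : g b - g a = (1 + a) `^ (- th) - (1 + b) `^ (- th)); last first.
    by rewrite /g; ring.
  apply: le_trans (powR_compression th0 _ _) _; [lra|lra|].
  apply: ler_wpM2l.
    rewrite subr_ge0 !powRN lef_pV2 ?posrE ?powR_gt0; try lra.
    by apply: ge0_ler_powR; rewrite ?nnegrE; lra.
  by apply: ge0_ler_powR; rewrite ?nnegrE; lra.
have g0 : g 0 = 0 by rewrite /g addr0 powR1 subrr.
have compressE u : compress th u = if 0 <= u then g u else - g (- u).
  by rewrite /compress /g; case: ifP => // _; rewrite opprB.
have mono u v : v <= u -> 1 + `|u| <= M -> 1 + `|v| <= M ->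
    th * (u - v) <= (compress th u - compress th v) * P.
  move=> vu; rewrite !compressE; have [u0|u0] := leP 0 u; have [v0|v0] := leP 0 v.
  - by rewrite (ger0_norm u0) => uM _; apply: base.
  - rewrite (ger0_norm u0) (ltr0_norm v0) => uM vM.
    have := base 0 u (lexx _) u0 uM; have := base 0 (- v) (lexx _) _ vM.
    by rewrite g0 oppr_ge0 (ltW v0) => /(_ isT); lra.
  - by exfalso; lra.
  - rewrite (ltr0_norm u0) (ltr0_norm v0) => uM vM.
    have := base (- u) (- v); rewrite oppr_ge0 (ltW u0) lerN2 vu vM.
    by move=> /(_ isT isT isT); lra.
have [st|ts] := leP s t.
- rewrite distrC ger0_norm ?subr_ge0//; apply: le_trans (mono _ _ st tM sM) _.
  by rewrite distrC ler_wpM2r// ler_norm.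
- have st0 : 0 <= s - t by rewrite subr_ge0 ltW.
  rewrite (ger0_norm st0); apply: le_trans (mono _ _ (ltW ts) sM tM) _.
  by rewrite ler_wpM2r// ler_norm.
Qed.

(** Bounding the power of the maximum by a sum separates [s] from [t], as the averaging over a cell
    requires. *)
Lemma sqr_dist_le_compress (R : realType) (th e s t : R) : 0 < th ->
  `|compress th s - compress th t| <= e ->
  (s - t) ^+ 2 <= (e / th) ^+ 2 *
    ((1 + `|s|) `^ (2 + 2 * th) + (1 + `|t|) `^ (2 + 2 * th)).
Proof.
move=> th0 ste; have e0 : 0 <= e by apply: le_trans ste.
have := dist_compress_le s t th0; set M := Num.max _ _ => le_st.
have M0 : 0 <= M by rewrite le_max addr_ge0.
have {le_st} : `|s - t| <= e / th * M `^ (1 + th).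
  rewrite mulrAC ler_pdivlMr// mulrC; apply: le_trans le_st _.
  by rewrite ler_wpM2r// powR_ge0.
have B0 : 0 <= e / th * M `^ (1 + th).
  by rewrite mulr_ge0 ?powR_ge0// divr_ge0// ltW.
move=> le_st; have {le_st} : `|s - t| ^+ 2 <= (e / th * M `^ (1 + th)) ^+ 2.
  by rewrite lerXn2r ?nnegrE.
rewrite real_normK ?num_real// exprMn => le_st; apply: le_trans le_st _.
rewrite ler_wpM2l ?sqr_ge0//.
have -> : (M `^ (1 + th)) ^+ 2 = M `^ (2 + 2 * th).
  by rewrite -powR_mulrn ?powR_ge0// -powRrM; congr (_ `^ _); ring.
by rewrite /M; case: (leP (1 + `|s|)) => _; rewrite ?lerDl ?lerDr powR_ge0.
Qed.

(** * Measurable partitions into boxes *)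

(** The index is the integer part of [m.+1%:R * X z]; the strict bound [X z < 1] keeps it below
    [m.+1]. *)
Lemma exists_uniform_index (R : realType) (d : measure_display)
    (T : measurableType d) (X : T -> R) (m : nat) :
  measurable_fun setT X -> (forall z, 0 <= X z < 1) ->
  exists q : T -> 'I_m.+1, (forall i, measurable (q @^-1` [set i])) /\
    forall z w, q z = q w -> `|X z - X w| <= m.+1%:R^-1.
Proof.
move=> mX X01.
have mX0 z : 0 <= m.+1%:R * X z by rewrite mulr_ge0//; case/andP: (X01 z).
have lt_m z : (Num.truncn (m.+1%:R * X z) < m.+1)%N.
  rewrite truncn_lt_nat// -[ltRHS]mulr1 ltr_pM2l//.
  by case/andP: (X01 z).
exists (fun z => Ordinal (lt_m z)); split=> [i|z w /(congr1 val)/= zw].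
- rewrite (_ : _ @^-1` _ = [set z | i%:R <= m.+1%:R * X z] `&`
      [set z | m.+1%:R * X z < i.+1%:R]); last first.
    apply/seteqP; split=> [z /= /(congr1 val) /= <-|z /= zi].
      by split; [rewrite truncn_le|exact: truncnS_gt].
    apply/val_inj => /=; apply/eqP; rewrite truncn_eq//; exact/andP.
  have mmX : measurable_fun setT (fun z => m.+1%:R * X z) by exact: measurable_funM.
  apply: measurableI.
  - rewrite -[X in measurable X]setTI.
    exact: (measurable_fun_ler (@measurable_cst _ _ T R setT i%:R) mmX
      measurableT (Y := [set true])).
  - rewrite -[X in measurable X]setTI.
    exact: (measurable_fun_ltr mmX (@measurable_cst _ _ T R setT i.+1%:R)
      measurableT (Y := [set true])).
- rewrite -div1r ler_pdivlMr// -[X in _ * X](@ger0_norm R)// -normrM mulrBl.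
  rewrite !(mulrC _ m.+1%:R).
  have := truncn_itv (mX0 z); have := truncn_itv (mX0 w).
  rewrite zw -natr1; rewrite ler_norml; lra.
Qed.

Lemma exists_box_index (R : realType) (d : measure_display)
    (T : measurableType d) (k : nat) (X : 'I_k -> T -> R) (m : nat) :
  (forall i, measurable_fun setT (X i)) -> (forall i z, 0 <= X i z < 1) ->
  exists q : T -> {ffun 'I_k -> 'I_m.+1},
    (forall b, measurable (q @^-1` [set b])) /\
    forall z w, q z = q w -> forall i, `|X i z - X i w| <= m.+1%:R^-1.
Proof.
move=> mX X01.
have /choice[q qP] := fun i => exists_uniform_index m (mX i) (X01 i).
exists (fun z => [ffun i => q i z]); split=> [b|z w /ffunP qzw i].
  rewrite (_ : _ @^-1` _ = \bigcap_(i in [set: 'I_k]) (q i @^-1` [set b i])).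
    by apply: fin_bigcap_measurable => // i _; apply: (qP i).1.
  apply/seteqP; split=> [z /= <- i _ /=|z zb /=]; first by rewrite ffunE.
  by apply/ffunP => i; rewrite ffunE; exact: zb.
by apply: (qP i).2; have := qzw i; rewrite !ffunE.
Qed.

(** * Marginals, coordinates and the Euclidean norm *)

(** Agreement on measurable sets suffices, because the integral depends on the measure only through
    them. *)
Lemma integral_marginal (R : realType) (d d' : measure_display)
    (T : measurableType d) (T' : measurableType d') (P : probability T R)
    (mu : probability T' R) (f : T -> T') (g : T' -> \bar R) :
  measurable_fun setT f ->
  (forall A, measurable A -> pushforward P f A = mu A) ->
  measurable_fun setT g -> (forall y, 0 <= g y)%E ->
  (\int[mu]_y g y = \int[P]_z g (f z))%E.
Proof.
move=> mf Pmu mg g0; have [P' [P'E P'int]] := exists_image_probability P mf.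
rewrite -P'int//; apply: eq_measure_integral => A mA _.
exact: (etrans (esym (Pmu A mA)) (esym (P'E A))).
Qed.

Lemma measurable_coord (R : realType) (d : nat) (i : 'I_d) :
  measurable_fun setT (fun x : eucl R d => x ord0 i).
Proof.
apply: (measurability _ (RGenOpens.measurableE R)) => _ [_ [a [b ->]] <-].
rewrite setTI; apply: sub_sigma_algebra.
have /continuousP := @coord_continuous R 1 d ord0 i.
by apply; exact: interval_open.
Qed.

Lemma sqr_enorm (R : realType) (d : nat) (x : 'rV[R]_d) :
  enorm x ^+ 2 = \sum_(i < d) x ord0 i ^+ 2.
Proof. by rewrite /enorm sqr_sqrtr// sumr_ge0// => i _; rewrite sqr_ge0. Qed.

Lemma enorm_ge0 (R : realType) (d : nat) (x : 'rV[R]_d) : 0 <= enorm x.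
Proof. exact: sqrtr_ge0. Qed.

Lemma coord_le_enorm (R : realType) (d : nat) (x : 'rV[R]_d) (i : 'I_d) :
  `|x ord0 i| <= enorm x.
Proof.
rewrite -[leRHS]ger0_norm ?enorm_ge0// -ler_sqr ?nnegrE// !real_normK ?num_real//.
by rewrite sqr_enorm (bigD1 i)//= lerDl sumr_ge0// => j _; rewrite sqr_ge0.
Qed.

Lemma measurable_enorm (R : realType) (d : nat) :
  measurable_fun setT (fun x : eucl R d => enorm x).
Proof.
have -> : (fun x : eucl R d => enorm x) =
    (fun x : eucl R d => (\sum_(i < d) x ord0 i ^+ 2) `^ 2^-1).
  apply/funext => x; rewrite powR12_sqrt// sumr_ge0// => i _.
  exact: sqr_ge0.
apply: (measurableT_comp (measurable_powR _)); apply: measurable_sum => i.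
by apply: measurable_funX; exact: measurable_coord.
Qed.

Lemma measurable_sqr_enormB (R : realType) (d : nat) (d' : measure_display)
    (T : measurableType d') (f g : T -> eucl R d) :
  measurable_fun setT f -> measurable_fun setT g ->
  measurable_fun setT (fun z => enorm (f z - g z : 'rV[R]_d) ^+ 2).
Proof.
move=> mf mg; rewrite (_ : (fun z => _) =
    fun z => \sum_(i < d) (f z ord0 i - g z ord0 i) ^+ 2); last first.
  by apply/funext => z; rewrite sqr_enorm; apply: eq_bigr => i _; rewrite !mxE.
apply: measurable_sum => i; apply: measurable_funX.
by apply: measurable_funB; apply: (measurableT_comp (measurable_coord i)).
Qed.

(** * Exchange identity and elementary inequalities *)

Lemma sqr_edistY (R : realType) (d : nat) (z w : 'rV[R]_d * 'rV[R]_d) :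
  edistY z w ^+ 2 = enorm (z.1 - w.1) ^+ 2 + enorm (z.2 - w.2) ^+ 2.
Proof. by rewrite /edistY /enormY sqr_sqrtr// addr_ge0 ?sqr_ge0. Qed.

(* With u = x + y and b = <x - x', y - y'>, this is
   |z - z'|^2 = |u - u'|^2 - 2 b, and -2 b is the gain of an exchange. *)
Lemma sqr_edistY_exchange (R : realType) (d : nat) (z w : 'rV[R]_d * 'rV[R]_d) :
  edistY w z ^+ 2 =
    \sum_(i < d) ((z.1 ord0 i + z.2 ord0 i) - (w.1 ord0 i + w.2 ord0 i)) ^+ 2 +
    (enorm (z.1 - z.2) ^+ 2 + enorm (w.1 - w.2) ^+ 2 -
     enorm (z.1 - w.2) ^+ 2 - enorm (w.1 - z.2) ^+ 2).
Proof.
rewrite sqr_edistY !sqr_enorm -!sumrN -!big_split /=; apply: eq_bigr => i _.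
by rewrite !mxE; ring.
Qed.

Lemma sqr_enormB_le (R : realType) (d : nat) (x y : 'rV[R]_d) :
  enorm (x - y) ^+ 2 <= 2 * (enorm x ^+ 2 + enorm y ^+ 2).
Proof.
rewrite !sqr_enorm -big_split /= mulr_sumr; apply: ler_sum => i _.
rewrite !mxE; have := sqr_ge0 (x ord0 i + y ord0 i); nra.
Qed.

Lemma sqr_le1D_powR (R : realType) (p s : R) : 2 <= p -> 0 <= s ->
  s ^+ 2 <= 1 + s `^ p.
Proof.
move=> p2 s0; have [s1|s1] := leP s 1.
  by apply: (@le_trans _ _ 1); [rewrite exprn_ile1|rewrite lerDl powR_ge0].
rewrite -powR_mulrn//; apply: (@le_trans _ _ (s `^ p)).
  by apply: ler_powR => //; exact: ltW.
by rewrite lerDr.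
Qed.

(** With [M] the largest of 1, [a] and [b], one has [1 + a + b <= 3 M], and [M^p] is one of the
    three terms of the sum. *)
Lemma powR_sum3_le (R : realType) (p a b : R) : 0 <= p -> 0 <= a -> 0 <= b ->
  (1 + a + b) `^ p <= 3 `^ p * (1 + a `^ p + b `^ p).
Proof.
move=> p0 a0 b0; have Pa := powR_ge0 a p; have Pb := powR_ge0 b p.
have key M : 1 <= M -> a <= M -> b <= M -> M `^ p <= 1 + a `^ p + b `^ p ->
    (1 + a + b) `^ p <= 3 `^ p * (1 + a `^ p + b `^ p).
  move=> M1 aM bM MH; apply: (@le_trans _ _ ((3 * M) `^ p)).
    by apply: ge0_ler_powR; rewrite ?nnegrE; lra.
  by rewrite powRM ?ler_wpM2l ?powR_ge0//; lra.
have [ab|ba] := leP a b.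
  have [b1|b1] := leP b 1.
    by apply: (key 1) => //; rewrite ?powR1; lra.
  by apply: (key b) => //; lra.
have [a1|a1] := leP a 1.
  by apply: (key 1) => //; rewrite ?powR1; lra.
by apply: (key a) => //; lra.
Qed.

(** Here [m.+1] is the integer part of the [d]-th root of [n]: the grid has at most [n] cells, and
    maximality gives [n < m.+2 ^ d], where [m.+2 <= 2 * m.+1]. *)
Lemma exists_root_bracket (d n : nat) : (0 < d)%N -> (0 < n)%N ->
  exists m, (m.+1 ^ d <= n <= (2 * m.+1) ^ d)%N.
Proof.
move=> d0 n0.
have P0 : exists m, (m.+1 ^ d <= n)%N by exists 0%N; rewrite exp1n.
have Pb m : (m.+1 ^ d <= n)%N -> (m <= n)%N.
  apply: leq_trans; apply: leq_trans (leqnSn m) _.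
  by rewrite -[X in (X <= _)%N]expn1 leq_pexp2l.
case: (ex_maxnP P0 Pb) => m mn mmax; exists m; rewrite mn /=.
have : ~~ (m.+2 ^ d <= n)%N by apply/negP => /mmax; rewrite ltnn.
rewrite -ltnNge => /ltnW/leq_trans; apply.
by rewrite leq_exp2r//; lia.
Qed.

(** * Finite moments under a coupling *)

Lemma coupling_integral_lty (R : realType) (d1 d2 : measure_display)
    (T1 : measurableType d1) (T2 : measurableType d2)
    (mu1 : probability T1 R) (mu2 : probability T2 R)
    (pi : probability (T1 * T2)%type R) (f1 : T1 -> R) (f2 : T2 -> R) :
  coupling mu1 mu2 pi ->
  measurable_fun setT f1 -> measurable_fun setT f2 ->
  (forall x, 0 <= f1 x) -> (forall y, 0 <= f2 y) ->
  (\int[mu1]_x (f1 x)%:E < +oo)%E -> (\int[mu2]_y (f2 y)%:E < +oo)%E ->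
  (\int[pi]_z (1 + f1 z.1 + f2 z.2)%:E < +oo)%E.
Proof.
move=> [pi1 pi2] mf1 mf2 f10 f20.
rewrite (integral_marginal measurable_fst pi1); first last.
- by move=> x; rewrite lee_fin.
- exact/measurable_EFinP.
rewrite (integral_marginal measurable_snd pi2); first last.
- by move=> x; rewrite lee_fin.
- exact/measurable_EFinP.
move=> fin1 fin2.
have m1 : measurable_fun setT (fun z : T1 * T2 => (f1 z.1)%:E).
  by apply/measurable_EFinP; exact: (measurableT_comp mf1 measurable_fst).
have m2 : measurable_fun setT (fun z : T1 * T2 => (f2 z.2)%:E).
  by apply/measurable_EFinP; exact: (measurableT_comp mf2 measurable_snd).
under eq_integral do rewrite !EFinD.
rewrite ge0_integralD//; first last.
- by move=> z _; rewrite lee_fin.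
- by apply: emeasurable_funD.
- by move=> z _; rewrite -EFinD lee_fin addr_ge0.
rewrite ge0_integralD//; last by move=> z _; rewrite lee_fin.
rewrite lte_add_pinfty// lte_add_pinfty//.
have -> : (\int[pi]_z 1 = 1 :> \bar R)%E; last exact: ltry.
rewrite -[RHS](probability_setT pi) -[RHS]mul1e.
exact: (integral_cst pi measurableT 1%E).
Qed.

Lemma integral_lty_dominated (R : realType) (d : measure_display)
    (T : measurableType d) (mu : {measure set T -> \bar R}) (f g : T -> R)
    (k : R) : measurable_fun setT f -> measurable_fun setT g -> 0 <= k ->
  (forall z, 0 <= f z <= k * g z) -> (forall z, 0 <= g z) ->
  (\int[mu]_z (g z)%:E < +oo)%E -> (\int[mu]_z (f z)%:E < +oo)%E.
Proof.
move=> mf mg k0 fkg g0 gfin.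
have mgE : measurable_fun setT (EFin \o g) by exact/measurable_EFinP.
apply: (@le_lt_trans _ _ (k%:E * \int[mu]_z (g z)%:E)%E); last first.
  by rewrite lte_mul_pinfty// lee_fin.
rewrite -ge0_integralZl//; last by move=> z _; rewrite lee_fin.
apply: ge0_le_integral => //.
- by move=> z _; rewrite lee_fin; case/andP: (fkg z).
- exact/measurable_EFinP.
- exact: measurable_funeM.
- by move=> z _; rewrite -EFinM lee_fin; case/andP: (fkg z).
Qed.

(** A single integrable weight that dominates, up to constants, the squared norm of [z] when
    [2 <= p] and the [p]-th powers of [1 + |u_i|] for [u = x + y]. *)
Definition moment_weight (R : realType) (d : nat) (p : R)
    (z : 'rV[R]_d * 'rV[R]_d) : R :=
  1 + enorm z.1 `^ p + enorm z.2 `^ p.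

Lemma moment_weight_ge1 (R : realType) (d : nat) (p : R)
    (z : 'rV[R]_d * 'rV[R]_d) : 1 <= moment_weight p z.
Proof. by rewrite /moment_weight -addrA lerDl addr_ge0 ?powR_ge0. Qed.

Lemma sqr_le_moment_weight (R : realType) (d : nat) (p : R)
    (z : 'rV[R]_d * 'rV[R]_d) : 2 <= p ->
  enorm z.1 ^+ 2 + enorm z.2 ^+ 2 <= 2 * moment_weight p z.
Proof.
move=> p2; rewrite /moment_weight.
have := lerD (sqr_le1D_powR p2 (enorm_ge0 z.1)) (sqr_le1D_powR p2 (enorm_ge0 z.2)).
move=> sq_le; apply: le_trans sq_le _.
move: (powR_ge0 (enorm z.1) p) (powR_ge0 (enorm z.2) p).
by move: (enorm z.1 `^ p) (enorm z.2 `^ p) => a b; lra.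
Qed.

Lemma measurable_moment_weight (R : realType) (d : nat) (p : R) :
  measurable_fun setT (fun z : euclY R d => moment_weight p z).
Proof.
have m1 := measurableT_comp (@measurable_enorm R d) (@measurable_fst _ _ _ _).
have m2 := measurableT_comp (@measurable_enorm R d) (@measurable_snd _ _ _ _).
by apply: measurable_funD; [apply: measurable_funD => //|];
  apply: (measurableT_comp (measurable_powR p)); [exact: m1|exact: m2].
Qed.

Lemma moment_weight_integral_lty (R : realType) (d : nat) (p : R)
    (mu1 mu2 : probability (eucl R d) R) (pi : probability (euclY R d) R) :
  in_P p mu1 -> in_P p mu2 -> coupling mu1 mu2 pi ->
  (\int[pi]_z (moment_weight p z)%:E < +oo)%E.
Proof.
move=> fin1 fin2 piC.
have mpow : measurable_fun setT (fun x : eucl R d => enorm x `^ p).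
  by apply: (measurableT_comp (measurable_powR p)); exact: measurable_enorm.
have pow0 (x : eucl R d) : 0 <= enorm x `^ p by exact: powR_ge0.
exact: (coupling_integral_lty piC mpow mpow pow0 pow0 fin1 fin2).
Qed.

(** * Cost within a cell and cost of a finitely valued map *)

(** The exchange identity splits the left side into the squared distance of the sums [u], bounded
    coordinate by coordinate through the compression, and a gain, bounded by its positive part,
    which integrates to zero for an optimal plan. *)
Lemma sqr_edistY_cell (R : realType) (d : nat) (th e : R)
    (z w : 'rV[R]_d * 'rV[R]_d) : 0 < th ->
  (forall i, `|compress th (z.1 ord0 i + z.2 ord0 i) -
               compress th (w.1 ord0 i + w.2 ord0 i)| <= e) ->
  edistY w z ^+ 2 <=
    d%:R * (e / th) ^+ 2 * 3 `^ (2 + 2 * th) *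
      (moment_weight (2 + 2 * th) z + moment_weight (2 + 2 * th) w) +
    Num.max 0 (enorm (z.1 - z.2) ^+ 2 + enorm (w.1 - w.2) ^+ 2 -
               enorm (z.1 - w.2) ^+ 2 - enorm (w.1 - z.2) ^+ 2).
Proof.
move=> th0 close; rewrite sqr_edistY_exchange; apply: lerD; last first.
  by rewrite le_max lexx orbT.
set p := 2 + 2 * th; have p0 : 0 <= p by rewrite /p; lra.
have coord (v : 'rV[R]_d * 'rV[R]_d) (i : 'I_d) :
    (1 + `|v.1 ord0 i + v.2 ord0 i|) `^ p <= 3 `^ p * moment_weight p v.
  apply: le_trans (powR_sum3_le p0 (enorm_ge0 v.1) (enorm_ge0 v.2)).
  have := coord_le_enorm v.1 i; have := coord_le_enorm v.2 i.
  have := ler_normD (v.1 ord0 i) (v.2 ord0 i) => h1 h2 h3.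
  have := normr_ge0 (v.1 ord0 i + v.2 ord0 i) => h4.
  by apply: ge0_ler_powR; rewrite ?nnegrE//; lra.
apply: (@le_trans _ _ (\sum_(i < d) (e / th) ^+ 2 *
    (3 `^ p * (moment_weight p z + moment_weight p w)))).
  apply: ler_sum => i _; apply: le_trans (sqr_dist_le_compress th0 (close i)) _.
  by rewrite ler_wpM2l ?sqr_ge0// mulrDr lerD.
rewrite sumr_const card_ord -mulr_natl le_eqVlt; apply/orP; left; apply/eqP.
by ring.
Qed.

(* The coupling bounding the distance is the law of (f z, z) under P. *)
Lemma W2_image_le (R : realType) (d : measure_display) (T : measurableType d)
    (dist : T -> T -> R) (P : probability T R) (f : T -> T) (S : set T) (B : R) :
  measurable_fun setT (fun v : T * T => dist v.1 v.2 ^+ 2) ->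
  measurable_fun setT f -> (forall z, S (f z)) -> 0 <= B ->
  (\int[P]_z (dist (f z) z ^+ 2)%:E <= (B ^+ 2)%:E)%E ->
  exists P' : probability T R, P' S = 1%E /\ (W2 dist P' P <= B%:E)%E.
Proof.
move=> mdist mf fS B0 intB.
have [P' [P'E _]] := exists_image_probability P mf.
exists P'; split.
  rewrite P'E -(probability_setT P); congr (P _).
  by apply/seteqP; split => // z _ /=; exact: fS.
have mfid : measurable_fun setT (fun z => (f z, z)) by exact: measurable_fun_pair.
have [g [gE gint]] := exists_image_probability P mfid.
have g_coupling : coupling P' P g.
  split=> A mA; first exact: (etrans (gE (fst @^-1` A)) (esym (P'E A))).
  exact: (gE (snd @^-1` A)).
have gcost : (transport_cost (fun x y => (dist x y ^+ 2)%R) g <= (B ^+ 2)%:E)%E.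
  rewrite /transport_cost gint//; first exact/measurable_EFinP.
  by move=> v; rewrite lee_fin sqr_ge0.
have inf_le : (ereal_inf [set transport_cost (fun x y => (dist x y ^+ 2)%R) g
    | g in coupling P' P] <= (B ^+ 2)%:E)%E.
  by apply: le_trans gcost; apply: ereal_inf_lbound; exists g.
(* The power [2^-1] is monotone on nonnegative extended reals, so the infimum is also shown to be
   nonnegative. *)
rewrite /W2; apply: (@le_trans _ _ ((B ^+ 2)%:E `^ 2^-1)%E).
  apply: gt0_ler_poweR => //; rewrite in_itv /= ?leey ?andbT ?lee_fin ?sqr_ge0//.
  apply: le_ereal_inf_tmp => _ [h _ <-].
  by apply: integral_ge0 => v _; rewrite lee_fin sqr_ge0.
by rewrite poweR_EFin powR12_sqrt ?sqr_ge0// sqrtr_sqr ger0_norm.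
Qed.

Lemma measurable_sqr_edistY (R : realType) (d : nat) (d' : measure_display)
    (T : measurableType d') (f g : T -> euclY R d) :
  measurable_fun setT f -> measurable_fun setT g ->
  measurable_fun setT (fun z => edistY (f z) (g z) ^+ 2).
Proof.
move=> mf mg; under eq_fun do rewrite sqr_edistY.
apply: measurable_funD; apply: measurable_sqr_enormB.
- exact: (measurableT_comp measurable_fst mf).
- exact: (measurableT_comp measurable_fst mg).
- exact: (measurableT_comp measurable_snd mf).
- exact: (measurableT_comp measurable_snd mg).
Qed.

Lemma measurable_fin_comp (d d' : measure_display) (T : measurableType d)
    (T' : measurableType d') (I : finType) (q : T -> I) (c : I -> T') :
  (forall i, measurable (q @^-1` [set i])) -> measurable_fun setT (c \o q).
Proof.
move=> mq _ A mA; rewrite setTI.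
have -> : (c \o q) @^-1` A = \bigcup_(i in [set i | A (c i)]) (q @^-1` [set i]).
  apply/seteqP; split=> [z Az|z [i /= Ai qzi]]; first by exists (q z).
  by rewrite /= qzi.
by apply: fin_bigcup_measurable => // i _.
Qed.

(** * Assembly of the quantizer *)

Unset Implicit Arguments.

Theorem lemma3p13 (R : realType) (d : nat) (d_ge1 : (1 <= d)%N)
    (delta : R) (delta_gt0 : 0 < delta)
    (mu1 mu2 : probability (eucl R d) R)
    (mu1P : in_P (2 + delta) mu1) (mu2P : in_P (2 + delta) mu2)
    (pi : probability (euclY R d) R)
    (pi_opt : optimal_transport
       (fun x y : eucl R d => enorm (x - y) ^+ 2) mu1 mu2 pi) :
  exists C : R, 0 < C /\ quant2 C (d%:R^-1) pi.
Proof.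
pose th := delta / 2; pose p := 2 + 2 * th.
have th0 : 0 < th by rewrite divr_gt0.
have pE : p = 2 + delta by rewrite /p /th; field.
have p2 : 2 <= p by rewrite pE; lra.
have H1 (z : 'rV[R]_d * 'rV[R]_d) : 1 <= moment_weight p z.
  exact: moment_weight_ge1.
have H0 (z : 'rV[R]_d * 'rV[R]_d) : 0 <= moment_weight p z.
  exact: le_trans ler01 (H1 z).
have mH := @measurable_moment_weight R d p.
have mHE : measurable_fun setT (fun z : euclY R d => (moment_weight p z)%:E).
  exact/measurable_EFinP.
have Hfin : (\int[pi]_z (moment_weight p z)%:E < +oo)%E.
  by rewrite pE; exact: moment_weight_integral_lty mu1P mu2P pi_opt.1.
have dom (f : euclY R d -> R) (k : R) : measurable_fun setT f -> 0 <= k ->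
    (forall z, 0 <= f z <= k * moment_weight p z) -> (\int[pi]_z (f z)%:E < +oo)%E.
  by move=> mf k0 fk; exact: (integral_lty_dominated mf mH k0 fk H0 Hfin).
have sq_le (z : 'rV[R]_d * 'rV[R]_d) :
    enorm z.1 ^+ 2 + enorm z.2 ^+ 2 <= 2 * moment_weight p z.
  exact: sqr_le_moment_weight.
have cost_fin : (transport_cost (fun x y : eucl R d => (enorm (x - y) ^+ 2)%R) pi < +oo)%E.
  apply: (dom _ (2 * 2)) => //.
    exact: measurable_sqr_enormB.
  move=> z; rewrite sqr_ge0 /=; apply: le_trans (sqr_enormB_le _ _) _.
  by rewrite -mulrA ler_wpM2l.
have mcost : measurable_fun setT (fun z : euclY R d => enorm (z.1 - z.2 : 'rV[R]_d) ^+ 2).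
  exact: measurable_sqr_enormB.
have N0 := optimal_transport_exchange mcost (fun x y => sqr_ge0 _) pi_opt cost_fin.
(* The constant of [sqr_edistY_cell] for [e = 2 / m.+1], with [m.+1 ^- 2] taken out. The 2 is the
   length of (-1, 1), which [X] below rescales to length 1. *)
pose K := d%:R * (2 / th) ^+ 2 * 3 `^ p.
have K0 : 0 < K by rewrite mulr_gt0 ?powR_gt0// mulr_gt0 ?ltr0n// exprn_gt0// divr_gt0.
pose M := fine (\int[pi]_z (moment_weight p z)%:E)%E.
have ME : (\int[pi]_z (moment_weight p z)%:E = M%:E)%E.
  rewrite fineK// ge0_fin_numE//; apply: integral_ge0 => z _; by rewrite lee_fin.
have M1 : 1 <= M.
  rewrite -lee_fin -ME -(probability_setT pi) -[leLHS]mul1e.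
  rewrite -(integral_cst pi measurableT).
  by apply: ge0_le_integral => // z _; rewrite lee_fin.
(* Under the root, [2 * K * M / m.+1 ^ 2] bounds the squared error, its 2 coming from averaging; the
   outer 2 pays for [n^(1/d) <= 2 * m.+1]. *)
pose C := 2 * Num.sqrt (2 * K * M).
have M0 : 0 < M := lt_le_trans ltr01 M1.
have KM0 : 0 < 2 * K * M := mulr_gt0 (mulr_gt0 (ltr0n R 2) K0) M0.
exists C; split; first by rewrite mulr_gt0// sqrtr_gt0.
split.
  have mEY : measurable_fun setT (fun z : euclY R d => enormY z `^ 2).
    under eq_fun do rewrite powR_mulrn ?sqrtr_ge0// sqr_sqrtr ?addr_ge0 ?sqr_ge0//.
    apply: measurable_funD; apply: measurable_funX.
    - exact: (measurableT_comp (@measurable_enorm R d) measurable_fst).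
    - exact: (measurableT_comp (@measurable_enorm R d) measurable_snd).
  apply: (dom _ 2 mEY) => // z; rewrite powR_ge0 /=.
  by rewrite powR_mulrn ?sqrtr_ge0// sqr_sqrtr ?addr_ge0 ?sqr_ge0.
move=> n n1; have [m /andP[mn nm]] := exists_root_bracket d_ge1 n1.
pose X i (z : euclY R d) := (1 + compress th (z.1 ord0 i + z.2 ord0 i)) / 2.
have mX i : measurable_fun setT (X i).
  apply: measurable_funM => //; apply: measurable_funD => //.
  apply: (measurableT_comp (measurable_compress th)); apply: measurable_funD.
  - exact: (measurableT_comp (measurable_coord i) measurable_fst).
  - exact: (measurableT_comp (measurable_coord i) measurable_snd).
have X01 i z : 0 <= X i z < 1.
  exact: compress_itv.
have [q [mq qX]] := exists_box_index m mX X01.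
pose W (z : euclY R d) := K / m.+1%:R ^+ 2 * moment_weight p z.
(* The second component is the representative and comes first in the distance, matching the pair
   [(f z, z)] in [W2_image_le]. *)
pose D (v : euclY R d * euclY R d) := edistY v.2 v.1 ^+ 2.
pose N (v : euclY R d * euclY R d) := Num.max 0
  (enorm (v.1.1 - v.1.2 : 'rV[R]_d) ^+ 2 + enorm (v.2.1 - v.2.2 : 'rV[R]_d) ^+ 2 -
   enorm (v.1.1 - v.2.2 : 'rV[R]_d) ^+ 2 - enorm (v.2.1 - v.1.2 : 'rV[R]_d) ^+ 2).
have mD : measurable_fun setT D.
  exact: measurable_sqr_edistY measurable_snd measurable_fst.
have mN : measurable_fun setT N.
  have m11 := measurableT_comp (@measurable_fst _ _ (eucl R d) (eucl R d))
    (@measurable_fst _ _ (euclY R d) (euclY R d)).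
  have m12 := measurableT_comp (@measurable_snd _ _ (eucl R d) (eucl R d))
    (@measurable_fst _ _ (euclY R d) (euclY R d)).
  have m21 := measurableT_comp (@measurable_fst _ _ (eucl R d) (eucl R d))
    (@measurable_snd _ _ (euclY R d) (euclY R d)).
  have m22 := measurableT_comp (@measurable_snd _ _ (eucl R d) (eucl R d))
    (@measurable_snd _ _ (euclY R d) (euclY R d)).
  apply: measurable_maxr => //; apply: measurable_funB.
    apply: measurable_funB; last exact: measurable_sqr_enormB m11 m22.
    apply: measurable_funD; first exact: measurable_sqr_enormB m11 m12.
    exact: measurable_sqr_enormB m21 m22.
  exact: measurable_sqr_enormB m21 m12.
have mW : measurable_fun setT W by exact: measurable_funM.
have D0 v : 0 <= D v by exact: sqr_ge0.
have N_ge0 v : 0 <= N v by rewrite le_max lexx.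
have Km0 : 0 <= K / m.+1%:R ^+ 2 by rewrite divr_ge0 ?sqr_ge0// ltW.
have W0 z : 0 <= W z by rewrite mulr_ge0.
have WE : (\int[pi]_z (W z)%:E = (K / m.+1%:R ^+ 2 * M)%:E)%E.
  rewrite EFinM -ME -ge0_integralZl//; last by move=> z _; rewrite lee_fin.
have Wfin : (\int[pi]_z (W z)%:E < +oo)%E by rewrite WE ltry.
have DWN z w : q z = q w -> D (z, w) <= W z + W w + N (z, w).
  move=> qzw.
  have close i : `|compress th (z.1 ord0 i + z.2 ord0 i) -
      compress th (w.1 ord0 i + w.2 ord0 i)| <= 2 / m.+1%:R.
    have := qX z w qzw i; rewrite /X -mulrBl normrM (ger0_norm (_ : 0 <= 2^-1))//.
    by rewrite ler_pdivrMr// mulrC opprD addrACA subrr add0r.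
  apply: le_trans (sqr_edistY_cell th0 close) _; rewrite lerD2r -mulrDr.
  rewrite le_eqVlt; apply/orP; left; apply/eqP; congr (_ * _).
  by rewrite /K; field; rewrite gt_eqF// gt_eqF// ltr0n.
have [c cP] := exists_cell_representatives mq mD mN mW D0 N_ge0 W0 Wfin N0 DWN.
(* One representative per box, empty boxes included: [m.+1 ^ d] entries, at most [n] by [mn]. *)
pose s := [seq c b | b <- enum {ffun 'I_d -> 'I_m.+1}].
pose B := C * n%:R `^ (- d%:R^-1).
have B0 : 0 <= B by rewrite mulr_ge0 ?powR_ge0// mulr_ge0// sqrtr_ge0.
have intB : (\int[pi]_z (edistY ((c \o q) z) z ^+ 2)%:E <= (B ^+ 2)%:E)%E.
  apply: le_trans cP _; rewrite WE -EFinM lee_fin.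
  have root_le : n%:R `^ d%:R^-1 <= 2 * m.+1%:R :> R.
    apply: (@le_trans _ _ (((2 * m.+1)%:R ^+ d) `^ d%:R^-1)).
      by apply: ge0_ler_powR; rewrite ?nnegrE ?invr_ge0 ?exprn_ge0// -natrX ler_nat.
    rewrite -powR_mulrn// -powRrM divff ?pnatr_eq0 -?lt0n//.
    by rewrite powRr1// natrM.
  have inv_le : (2 * m.+1%:R)^-1 <= n%:R `^ (- d%:R^-1) :> R.
    by rewrite powRN lef_pV2 ?posrE ?powR_gt0 ?mulr_gt0 ?ltr0n.
  rewrite /B exprMn [C ^+ 2]exprMn sqr_sqrtr ?(ltW KM0)//.
  apply: (@le_trans _ _ (2 ^+ 2 * (2 * K * M) * (2 * m.+1%:R)^-1 ^+ 2)).
    rewrite le_eqVlt; apply/orP; left; apply/eqP; field.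
    by rewrite addrC natr1.
  apply: ler_wpM2l; first by apply: mulr_ge0; [exact: sqr_ge0|exact: ltW].
  by rewrite lerXn2r ?nnegrE ?powR_ge0// invr_ge0 mulr_ge0.
have cs z : [set` s] ((c \o q) z) by rewrite /= map_f ?mem_enum.
have [pin [pin1 pinW]] := W2_image_le
  (measurable_sqr_edistY measurable_fst measurable_snd) (measurable_fin_comp c mq) cs B0 intB.
exists pin, s; split => //.
by rewrite size_map -cardE card_ffun !card_ord.
Qed.
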